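(* Let $(X,\tau)$ be a Hausdorff topological space in which every $\omega$-cover has a countable subset that is an $\omega$-cover. Then the following statements are equivalent: (1) $\textsf{S}_1(\Omega,\Omega)$; (2) ${\sf E}(\Omega,\Omega)$; (3) ${\sf GP}(\Omega,\Omega)$; (4) ${\sf FG}(\Omega,\Omega)$; (5) ${\sf NW}(\Omega,\Omega)$; (6) for all positive integers $n$ and $k$, $\Omega\rightarrow(\Omega)^n_k$; (7) for all positive integers $n$ and $k$, $\Omega\rightarrow[\Omega]^n_{k/\le 2}$; (8) $\Omega\rightarrow[\Omega]^2_{3}$ (that is, $\Omega\rightarrow[\Omega]^2_{3/\le 2}$); (9) $\Omega\rightarrow(\Omega,4)^3$; (10) $\Omega\rightarrow(\Omega)^2_2$; (11) $\Omega\rightarrow(\Omega,\mathcal{O})^2$.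
   Context: An open cover $\mathcal{U}$ of $X$ is an $\omega$-cover if $X\notin\mathcal{U}$ and every finite subset of $X$ is contained in some member of $\mathcal{U}$; $\Omega$ is the set of $\omega$-covers of $X$ and $\mathcal{O}$ the set of open covers of $X$. For families $\mathcal{A},\mathcal{B}$, $\textsf{S}_1(\mathcal{A},\mathcal{B})$ means: for every sequence $(O_n:n\in\mathbb{N})$ of elements of $\mathcal{A}$ there are $T_n\in O_n$ with $\{T_n:n\in\mathbb{N}\}\in\mathcal{B}$. For a set $S$, $[S]^m$ is the set of $m$-element subsets, $[S]^{<\aleph_0}$ the finite subsets, $[S]^{\aleph_0}$ the countably infinite subsets. Partition relations: $\mathcal{A}\rightarrow(\mathcal{B})^m_k$ means for each $A\in\mathcal{A}$ and each $f:[A]^m\to\{1,\dots,k\}$ there are $i$ and $B\subseteq A$, $B\in\mathcal{B}$, with $f$ constant equal to $i$ on $[B]^m$. $\mathcal{A}\rightarrow(\mathcal{B}_1,\mathcal{B}_2)^m$ means for each $A\in\mathcal{A}$ and $f:[A]^m\to\{1,2\}$ there are $i\in\{1,2\}$ and $B\subseteq A$ with $B\in\mathcal{B}_i$ and $f$ constant equal to $i$ on $[B]^m$; in $\Omega\rightarrow(\Omega,4)^3$ the second family is the family of $4$-element sets, and in $\Omega\rightarrow(\Omega,\mathcal{O})^2$ it is $\mathcal{O}$. $\mathcal{A}\rightarrow[\mathcal{B}]^m_{k/\le\ell}$ means for each $A\in\mathcal{A}$ and $f:[A]^m\to\{1,\dots,k\}$ there is $B\subseteq A$, $B\in\mathcal{B}$,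 with $|f[[B]^m]|\le\ell$; $\mathcal{A}\rightarrow[\mathcal{B}]^m_k$ abbreviates $\mathcal{A}\rightarrow[\mathcal{B}]^m_{k/\le k-1}$. For a countably infinite set $A$ with a fixed bijective enumeration $(a_n:n\in\mathbb{N})$: for nonempty $s,T\subseteq A$, $s<T$ means $a_n\in s$, $a_m\in T$ imply $n<m$; for finite $s$ and infinite $B$, $s<B$ means $s=\emptyset$ or $\max s<\min B$; $[s,B]=\{s\cup C\in[A]^{\aleph_0}: s<C\subseteq B\}$. These sets form a basis of the Ellentuck topology on $[A]^{\aleph_0}$; subsets carry the subspace topology. For $B\subseteq A$ and finite $s$, $B|s=\{a_n\in B: s<\{a_n\}\}$. A finite $s\subseteq C$ is an initial segment of $C$ if $s<C\setminus s$. A set has the Baire property if it is of the form $(U\setminus M)\cup(M\setminus U)$ with $U$ open and $M$ meager. ${\sf E}(\Omega,\Omega)$: for each countably infinite $A\in\Omega$ and each $R\subseteq[A]^{\aleph_0}\cap\Omega$ having the Baire property in the Ellentuck topology on $[A]^{\aleph_0}\cap\Omega$, for each $S\subseteq A$ with $S\in\Omega$ and each finite $s\subseteq A$ there is an infinite $B\subseteq S|s$ with $B\in\Omega$ such that $[s,B]\cap\Omega\subseteq R$ or $[s,B]\cap\Omega\cap R=\emptyset$. ${\sf GP}(\Omega,\Omega)$: for each countably infinite $A\in\Omega$ and each $R\subseteq[A]^{\aleph_0}\cap\Omega$ that is open in the topology on $[A]^{\aleph_0}\cap\Omega$ inherited from $2^A$ (identifying sets with characteristic functions), for each $S\in[A]^{\aleph_0}\cap\Omega$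 there is $B\in[S]^{\aleph_0}\cap\Omega$ with $[B]^{\aleph_0}\cap\Omega\subseteq R$ or $[B]^{\aleph_0}\cap\Omega\cap R=\emptyset$. A family $\mathcal{S}\subseteq[A]^{<\aleph_0}$ is dense if $\mathcal{S}\cap[B]^{<\aleph_0}\neq\emptyset$ for every $B\in[A]^{\aleph_0}\cap\Omega$, and thin if no element of $\mathcal{S}$ is an initial segment of another. ${\sf FG}(\Omega,\Omega)$: for each countably infinite $A\in\Omega$ and each dense $\mathcal{S}\subseteq[A]^{<\aleph_0}$ there is $B\in[A]^{\aleph_0}\cap\Omega$ such that every $C\in[B]^{\aleph_0}\cap\Omega$ has an initial segment in $\mathcal{S}$. ${\sf NW}(\Omega,\Omega)$: for each countably infinite $A\in\Omega$, each thin $\mathcal{T}\subseteq[A]^{<\aleph_0}$, each $n$ and each partition $\mathcal{T}=\mathcal{T}_1\cup\dots\cup\mathcal{T}_n$ there are $B\in[A]^{\aleph_0}\cap\Omega$ and $i$ with $[B]^{<\aleph_0}\cap\mathcal{T}\subseteq\mathcal{T}_i$. *)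

(* Defs.v *)
From HB Require Import structures.
From mathcomp Require Import all_boot.
From mathcomp Require Import boolp classical_sets functions cardinality topology.
Set Implicit Arguments. Unset Strict Implicit. Unset Printing Implicit Defensive.
Local Open Scope classical_set_scope.
Local Open Scope card_scope.

Section Defs.
Variable X : topologicalType.

Definition open_cover (U : set (set X)) : Prop :=
  (forall u, U u -> open u) /\ \bigcup_(u in U) u = [set: X].

Definition omega_cover (U : set (set X)) : Prop :=
  open_cover U /\ ~ U [set: X] /\
  (forall F : set X, finite_set F -> exists2 u, U u & F `<=` u).

Definition Omega : set (set (set X)) := [set U | omega_cover U].
Definition Ocov  : set (set (set X)) := [set U | open_cover U].

Definition S1 (A B : set (set (set X))) : Prop :=
  forall O : nat -> set (set X), (forall n, A (O n)) ->
  exists T : nat -> set X, (forall n, O n (T n)) /\ B (range T).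

Definition ctbl_inf {T} (D : set T) : Prop := countable D /\ infinite_set D.

Definition msub {T} (S : set T) (m : nat) : set (set T) :=
  [set s | s `<=` S /\ s #= `I_m].
Definition finsub {T} (S : set T) : set (set T) :=
  [set s | s `<=` S /\ finite_set s].
Definition ctsub {T} (S : set T) : set (set T) :=
  [set D | D `<=` S /\ ctbl_inf D].

Definition arrow {T} (A B : set (set T)) (m k : nat) : Prop :=
  forall U, A U -> forall f : set T -> nat,
  (forall s, msub U m s -> (1 <= f s <= k)%N) ->
  exists i, (1 <= i <= k)%N /\
    exists V, V `<=` U /\ B V /\ (forall s, msub V m s -> f s = i).

Definition arrow2 {T} (A B1 B2 : set (set T)) (m : nat) : Prop :=
  forall U, A U -> forall f : set T -> nat,
  (forall s, msub U m s -> f s = 1%N \/ f s = 2%N) ->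
  (exists V, V `<=` U /\ B1 V /\ (forall s, msub V m s -> f s = 1%N)) \/
  (exists V, V `<=` U /\ B2 V /\ (forall s, msub V m s -> f s = 2%N)).

Definition arrow_sq {T} (A B : set (set T)) (m k l : nat) : Prop :=
  forall U, A U -> forall f : set T -> nat,
  (forall s, msub U m s -> (1 <= f s <= k)%N) ->
  exists V, V `<=` U /\ B V /\ [set f s | s in msub V m] #<= `I_l.

Definition four_sets {T} : set (set T) := [set V | V #= `I_4].

Definition enum_of {T} (e : nat -> T) (A : set T) : Prop :=
  injective e /\ range e = A.

(* s < T w.r.t. the enumeration e (vacuous when s or T is empty) *)
Definition elt {T} (e : nat -> T) (s C : set T) : Prop :=
  forall n m, s (e n) -> C (e m) -> (n < m)%N.

Definition restr {T} (e : nat -> T) (B s : set T) : set T :=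
  [set a | B a /\ elt e s [set a]].

Definition init_seg {T} (e : nat -> T) (s C : set T) : Prop :=
  finite_set s /\ s `<=` C /\ elt e s (C `\` s).

Definition ell_basic {T} (e : nat -> T) (A s B : set T) : set (set T) :=
  [set D | ctsub A D /\ exists C, D = s `|` C /\ elt e s C /\ C `<=` B].

Definition ell_open {T} (e : nat -> T) (A : set T) (U : set (set T)) : Prop :=
  U `<=` ctsub A /\
  forall D, U D -> exists s B, finsub A s /\ B `<=` A /\ infinite_set B /\
    ell_basic e A s B D /\ ell_basic e A s B `<=` U.

Section Subspace.
Variable Z : Type.
Variable op : set Z -> Prop.
Variable Y : set Z.

Definition sub_open (W : set Z) : Prop := exists U, op U /\ W = U `&` Y.
Definition sub_closure (N : set Z) : set Z :=
  [set y | Y y /\ forall W, sub_open W -> W y -> W `&` N !=set0].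
Definition sub_interior (C : set Z) : set Z :=
  [set y | exists W, sub_open W /\ W y /\ W `<=` C].
Definition sub_nowhere_dense (N : set Z) : Prop :=
  N `<=` Y /\ sub_interior (sub_closure N) = set0.
Definition sub_meager (M : set Z) : Prop :=
  exists N : nat -> set Z, (forall n, sub_nowhere_dense (N n)) /\
    M = \bigcup_n N n.
Definition sub_baire (R : set Z) : Prop :=
  exists U M, sub_open U /\ sub_meager M /\ R = (U `\` M) `|` (M `\` U).
End Subspace.

(* open sets of 2^A (product topology), points are subsets of A *)
Definition cantor_open {T} (A : set T) (U : set (set T)) : Prop :=
  (forall D, U D -> D `<=` A) /\
  forall D, U D -> exists F G, finite_set F /\ finite_set G /\
    F `<=` D /\ G `&` D = set0 /\
    [set D' | D' `<=` A /\ F `<=` D' /\ G `&` D' = set0] `<=` U.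

Definition ctOmega : set (set (set X)) := [set A | Omega A /\ ctbl_inf A].

Definition E_OO : Prop :=
  forall (A : set (set X)) (e : nat -> set X), ctOmega A -> enum_of e A ->
  forall R : set (set (set X)), R `<=` ctsub A `&` Omega ->
  sub_baire (ell_open e A) (ctsub A `&` Omega) R ->
  forall S, S `<=` A -> Omega S ->
  forall s, finsub A s ->
  exists B, B `<=` restr e S s /\ infinite_set B /\ Omega B /\
    (ell_basic e A s B `&` Omega `<=` R \/
     ell_basic e A s B `&` Omega `&` R = set0).

Definition GP_OO : Prop :=
  forall A : set (set X), ctOmega A ->
  forall R : set (set (set X)), R `<=` ctsub A `&` Omega ->
  sub_open (cantor_open A) (ctsub A `&` Omega) R ->
  forall S, (ctsub A `&` Omega) S ->
  exists B, (ctsub S `&` Omega) B /\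
    (ctsub B `&` Omega `<=` R \/ ctsub B `&` Omega `&` R = set0).

Definition dense_fam (A : set (set X)) (Sf : set (set (set X))) : Prop :=
  Sf `<=` finsub A /\
  forall B, (ctsub A `&` Omega) B -> Sf `&` finsub B !=set0.
Definition thin_fam (e : nat -> set X) (A : set (set X)) (Tf : set (set (set X))) : Prop :=
  Tf `<=` finsub A /\
  forall s t, Tf s -> Tf t -> s <> t -> ~ init_seg e s t.

Definition FG_OO : Prop :=
  forall (A : set (set X)) (e : nat -> set X), ctOmega A -> enum_of e A ->
  forall Sf, dense_fam A Sf ->
  exists B, (ctsub A `&` Omega) B /\
    forall C, (ctsub B `&` Omega) C -> exists s, Sf s /\ init_seg e s C.

Definition NW_OO : Prop :=
  forall (A : set (set X)) (e : nat -> set X), ctOmega A -> enum_of e A ->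
  forall Tf, thin_fam e A Tf ->
  forall (n : nat) (Tp : nat -> set (set (set X))), (1 <= n)%N ->
  Tf = \bigcup_(i in [set i | (1 <= i <= n)%N]) Tp i ->
  (forall i j, (1 <= i <= n)%N -> (1 <= j <= n)%N -> i <> j ->
     Tp i `&` Tp j = set0) ->
  exists B i, (ctsub A `&` Omega) B /\ (1 <= i <= n)%N /\
    finsub B `&` Tf `<=` Tp i.

End Defs.

(* Main.v *)
(** Fix a countable omega-cover A and enumerate it by nat; the sets of indices of
   omega-subcovers form a coideal H on nat.  S1(Omega,Omega) makes H selective: one
   application of S1 gives a pseudo-intersection of a decreasing sequence, a second
   one, applied to finite intersections of members of A lying in distinct blocks,
   gives an omega-subcover meeting every block of an interval partition at most
   once, and keeping the blocks of one parity turns the pseudo-intersection into a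
   diagonalization.  For a selective coideal the Galvin-Prikry-Ellentuck accept /
   reject argument goes through relative to H, which is E(Omega,Omega); the
   properties GP, FG, NW and the partition relations follow by colouring according
   to initial segments.  Conversely, given omega-covers O_i, consider the
   omega-cover of all sets  v_0n /\ v_nm /\ z  with  v_ij  enumerating O_i and z in
   O_<n,m>.  An omega-subcover in which n determines m, or in which (n,m) determines
   the set, yields a selector of (O_i), while n is unbounded on every
   omega-subcover; colourings of pairs and triples in terms of n and m then show
   that each of (8), (9), (11) implies S1(Omega,Omega). *)
Require Import Defs.
From HB Require Import structures.
From mathcomp Require Import all_boot.
From mathcomp Require Import boolp classical_sets functions cardinality topology.
From mathcomp Require Import finmap zify.
Local Open Scope classical_set_scope.
Local Open Scope card_scope.
Set Implicit Arguments.
Unset Strict Implicit.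

(** * Ellentuck's theorem relative to a selective coideal *)

Section SelectiveCoideal.
Variable H : set (set nat).
Hypothesis H_up : forall B C, H B -> B `<=` C -> H C.
Hypothesis H_setU : forall B C, H (B `|` C) -> H B \/ H C.
Hypothesis H_unbounded : forall B, H B -> forall n, exists2 i, (n <= i)%N & B i.
(** Selectivity in the sense of Mathias: [D] diagonalizes the sequence, so a property secured on
    [B n] reaches the part of [D] beyond [n], for each [n] in [D]. *)
Hypothesis H_selective : forall B : nat -> set nat,
  (forall n, H (B n)) -> (forall n, B n.+1 `<=` B n) ->
  exists D, [/\ H D, D `<=` B 0%N &
    forall n m, D n -> D m -> (n < m)%N -> B n m].

Definition tail (n : nat) (B : set nat) : set nat := [set i | B i /\ (n <= i)%N].

(* The basic Ellentuck set [s, B], restricted to H; n bounds s from above and only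
   the part of B beyond n matters. *)
Definition nbhd_cond (n : nat) (s B : set nat) : set (set nat) :=
  [set D | [/\ H D, forall i, (i < n)%N -> (D i <-> s i) &
             forall i, (n <= i)%N -> D i -> B i]].

Lemma H_tail n B : H B -> H (tail n B).
Proof.
move=> HB; have [//|Hfin] : H (tail n B) \/ H (B `&` `I_n).
  apply: H_setU; apply: H_up HB _ => i Bi.
  by case: (leqP n i) => ni; [left|right].
by have [i ni [_ /=]] := H_unbounded Hfin n; rewrite ltnNge ni.
Qed.

Lemma nbhd_condS n s B C : B `<=` C -> nbhd_cond n s B `<=` nbhd_cond n s C.
Proof. by move=> BC D [HD Ds DB]; split=> // i ni /(DB i ni)/BC. Qed.

Lemma nbhd_cond_tail n s B : nbhd_cond n s B `<=` nbhd_cond n s (tail n B).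
Proof. by move=> D [HD Ds DB]; split=> // i ni /(DB i ni). Qed.

Lemma nbhd_cond0 n (s B : set nat) : s `<=` `I_n -> H B ->
  nbhd_cond n s B (s `|` tail n B).
Proof.
move=> sn HB; split.
- by apply: H_up (H_tail n HB) _; exact: subsetUr.
- move=> i lin; split=> [[//|[_]]|si]; last by left.
  by rewrite leqNgt lin.
- by move=> i ni [/sn/=|[]//]; rewrite ltnNge ni.
Qed.

Section Fusion.
Variable S : set nat.
Variable P : nat -> set nat -> set nat -> Prop.
Hypothesis P_hered : forall n s B C, P n s B -> C `<=` B -> H C -> P n s C.
Hypothesis P_dense : forall n (s : set nat) B, s `<=` `I_n -> B `<=` S -> H B ->
  exists C, [/\ C `<=` B, H C & P n s C].

(* There are only finitely many s below m; the induction adjoins a fixed set t so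
   that both cases, m in s or not, are instances of the hypothesis. *)
Lemma dense_simultaneous m n B : (m <= n)%N -> B `<=` S -> H B ->
  exists C, [/\ C `<=` B, H C & forall s : set nat, s `<=` `I_m -> P n s C].
Proof.
have gen : forall m n (t : set nat) B, (m <= n)%N -> t `<=` `I_n ->
    B `<=` S -> H B -> exists C, [/\ C `<=` B, H C &
    forall s : set nat, s `<=` `I_m -> P n (s `|` t) C].
  elim=> [|{}m IH] {}n t {}B mn tn BS HB.
    have [C [CB HC PC]] := P_dense tn BS HB; exists C; split=> // s s0.
    suff -> : s = set0 by rewrite set0U.
    by rewrite -subset0 => i /s0.
  have [C [CB HC PC]] := IH n t B (ltnW mn) tn BS HB.
  have tn' : [set m] `|` t `<=` `I_n by move=> i [->|/tn].
  have [E [EC HE PE]] := IH n _ C (ltnW mn) tn' (subset_trans CB BS) HC.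
  exists E; split=> // [|s sm]; first exact: subset_trans CB.
  have [smm|smm] := pselect (s m); last first.
    apply: P_hered (PC s _) EC HE => i si /=; have /= := sm i si.
    by rewrite ltnS leq_eqVlt => /orP[/eqP im|//]; rewrite im in si.
  have -> : s `|` t = (s `\ m) `|` ([set m] `|` t).
    apply/seteqP; split=> i.
      move=> [si|ti]; last by right; right.
      by have [->|im] := eqVneq i m; [right; left | left; split=> //; exact/eqP].
    by move=> [[si _]|[->|ti]]; [left|left|right].
  apply: PE => i [si /eqP im]; have /= := sm i si.
  by rewrite ltnS leq_eqVlt (negPf im).
move=> mn BS HB; have [C [CB HC PC]] := gen m n set0 B mn (@sub0set _ _) BS HB.
by exists C; split=> // s sm; rewrite -(setU0 s); apply: PC.
Qed.

(** A decreasing sequence [B n] settles at stage [n] all stems below [n.+1]. For [n] in a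
    diagonalization [D], the part of [D] beyond [n] lies in [B n] and inherits [P]. Restricting to
    [n] in [D] does no harm, as a nonempty stem from [D] can be bounded by the successor of its last
    element. *)
Lemma fusion : H S -> exists D, [/\ D `<=` S, H D &
  forall n (s : set nat), D n -> s `<=` `I_n.+1 -> P n.+1 s (tail n.+1 D)].
Proof.
move=> HS.
pose good n B := B `<=` S /\ H B /\ forall s : set nat, s `<=` `I_n.+1 -> P n.+1 s B.
have step n B : B `<=` S -> H B -> exists C, C `<=` B /\ good n C.
  move=> BS HB; have [C [CB HC PC]] := dense_simultaneous (leqnn n.+1) BS HB.
  by exists C; split=> //; split=> //; exact: subset_trans BS.
(* When a premise fails, a dummy value is returned, so that [choice] yields a total function. *)
have /choice[nxt nxtP] : forall x : nat * set nat, exists C,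
    x.2 `<=` S -> H x.2 -> C `<=` x.2 /\ good x.1 C.
  move=> [n B] /=; have [BS|nBS] := pselect (B `<=` S); last by exists B.
  have [HB|nHB] := pselect (H B); last by exists B.
  by have [C ?] := step n B BS HB; exists C.
pose B := fix B n := if n is k.+1 then nxt (k.+1, B k) else nxt (0%N, S).
have goodB n : good n (B n).
  elim: n => [|n [BS [HB _]]] /=; first by have [] := nxtP (0%N, S) (@subset_refl _ _) HS.
  by have [] := nxtP (n.+1, B n) BS HB.
have [D [HD D0 Dsel]] : exists D, [/\ H D, D `<=` B 0%N &
    forall n m, D n -> D m -> (n < m)%N -> B n m].
  apply: H_selective => n; first by case: (goodB n) => _ [].
  have [BS [HB _]] := goodB n.
  by have [] := nxtP (n.+1, B n) BS HB.
exists D; split=> // [|n s Dn sn]; first by have [BS _] := goodB 0%N; exact: subset_trans BS.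
have [_ [_ PB]] := goodB n.
by apply: P_hered (PB s sn) _ (H_tail _ HD) => i [Di ni]; exact: Dsel.
Qed.
End Fusion.

(** Relative Ellentuck openness. The sets [nbhd_cond n D D] suffice as a base at [D]: any [s,B]
    containing [D] contains the one whose [n] bounds s. *)
Definition ell_nbhd_open (R : set (set nat)) := forall D, H D -> R D ->
  exists n, nbhd_cond n D D `<=` R.

Section OpenRamsey.
Variable R : set (set nat).
Hypothesis R_open : ell_nbhd_open R.

Let acc n s B := nbhd_cond n s B `<=` R.
Let rej n s B := forall C, C `<=` B -> H C -> ~ acc n s C.

Lemma decide_dense n s B : H B ->
  exists C, [/\ C `<=` B, H C & acc n s C \/ rej n s C].
Proof.
move=> HB; have [[C [CB [HC aC]]]|nC] :=
  pselect (exists C, C `<=` B /\ H C /\ acc n s C).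
  by exists C; split=> //; left.
exists B; split=> //; right=> C CB HC aC; apply: nC.
by exists C.
Qed.

Lemma acc_sub n s B C : acc n s B -> C `<=` B -> acc n s C.
Proof. by move=> aB CB D /(nbhd_condS CB)/aB. Qed.

Lemma rej_sub n s B C : rej n s B -> C `<=` B -> rej n s C.
Proof. by move=> rB CB E EC; apply: rB; exact: subset_trans CB. Qed.

(** If no subset accepts the stem, two fusions give a reservoir in which rejection passes from a
    stem to each of its one-point extensions. All finite stretches of a member [D] are then
    rejected, whereas [D] in the open set [R] would force one of them to be accepted. *)
Lemma open_ramsey n0 (s0 : set nat) S : s0 `<=` `I_n0 -> H S ->
  exists B, [/\ B `<=` S, H B &
    nbhd_cond n0 s0 B `<=` R \/ nbhd_cond n0 s0 B `<=` ~` R].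
Proof.
move=> s0n0 HS.
have [S1 [S1S HS1 dS1]] := decide_dense n0 s0 HS.
have [D0 [D0S1 HD0 dD0]] : exists D, [/\ D `<=` S1, H D & forall n (s : set nat),
    D n -> s `<=` `I_n.+1 -> acc n.+1 s (tail n.+1 D) \/ rej n.+1 s (tail n.+1 D)].
  apply: (@fusion S1 (fun n s B => acc n s B \/ rej n s B)) => //.
  - by move=> n s B C [aB|rB] CB HC; [left; exact: acc_sub CB|right; exact: rej_sub CB].
  - by move=> n s B _ _ HB; exact: decide_dense.
case: dS1 => [aS1|rS1].
  exists S1; split=> //; by left.
(* Conditions with stem bound [n.+1] see the reservoir only from [n.+1] on, so [D0] and its tail
   accept or reject alike. *)
have {}dD0 n (s : set nat) : D0 n -> s `<=` `I_n.+1 -> acc n.+1 s D0 \/ rej n.+1 s D0.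
  move=> Dn sn; have [aD|rD] := dD0 n s Dn sn; [left|right].
    by move=> D /nbhd_cond_tail/aD.
  move=> C CD HC aC; apply: (rD (tail n.+1 C)).
  - by move=> i [/CD Di ni].
  - exact: H_tail.
  - by apply: acc_sub aC _ => i [].
(* If D0 rejects s, then H-almost all m in D0 are such that D0 rejects s with m added:
   otherwise the m for which D0 accepts would themselves accept s. *)
pose Q n (s B : set nat) := rej n s D0 ->
  forall m, B m -> (n <= m)%N -> rej m.+1 (s `|` [set m]) D0.
have Qhered n s B C : Q n s B -> C `<=` B -> H C -> Q n s C.
  by move=> QB CB _ rn m /CB; exact: QB.
have Qdense n (s : set nat) B : s `<=` `I_n -> B `<=` D0 -> H B ->
    exists C, [/\ C `<=` B, H C & Q n s C].
  move=> sn BD0 HB; have [rn|nrn] := pselect (rej n s D0); last by exists B; split.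
  pose C := [set m | B m /\ ((n <= m)%N -> rej m.+1 (s `|` [set m]) D0)].
  have [HC|HC] : H C \/ H (B `\` C).
    by apply: H_setU; apply: H_up HB _ => i Bi; have [|] := pselect (C i); [left|right].
    by exists C; split=> // [m []//|_ m [_]].
  have CD0 : B `\` C `<=` D0 by move=> i [/BD0].
  case: (rn _ CD0 HC) => D [HD Ds DC].
  have exm : exists m, (n <= m)%N && `[< D m >].
    by have [m nm Dm] := H_unbounded HD n; exists m; rewrite nm; apply/asboolP.
  (* Since [m] is the least element of [D] from [n] on, [D] belongs to the condition with [m] added
     to the stem; were this accepted by [D0], [D] would be in [R]. *)
  case: (ex_minnP exm) => m /andP[nm /asboolP Dm] minm.
  have [Bm nCm] := DC m nm Dm.
  have smm : s `|` [set m] `<=` `I_m.+1.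
    move=> i [/sn/= lin|->//=]; lia.
  have [aD|rD] := dD0 m _ (BD0 _ Bm) smm; last by exfalso; apply: nCm; split.
  apply: aD; split=> // [i im|i mi Di].
    split=> [Di|[si|->//]].
      case: (leqP n i) => ni; last by left; apply/Ds.
      right => /=; suff: (m <= i)%N by lia.
      by apply: minm; rewrite ni; apply/asboolP.
    by have /= lin := sn i si; apply/Ds.
  by apply: CD0; apply: DC => //; lia.
have HS0 : rej n0 s0 D0 by exact: rej_sub D0S1.
have [D1 [D1D0 HD1 QD1]] := Qdense n0 s0 D0 s0n0 (@subset_refl _ _) HD0.
have [D2 [D2D1 HD2 QD2]] : exists D, [/\ D `<=` D1, H D &
    forall n (s : set nat), D n -> s `<=` `I_n.+1 -> Q n.+1 s (tail n.+1 D)].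
  apply: fusion => // n s B sn BD1 HB; apply: Qdense => //.
  exact: subset_trans D1D0.
exists D2; split=> //; first by apply: subset_trans S1S; apply: subset_trans D0S1; apply: subset_trans D1D0.
right=> D [HD Ds DB] RD.
pose cut n := D `&` `I_n.
have cutn0 : cut n0 = s0.
  apply/seteqP; split=> i; first by move=> [Di /= lin]; apply/Ds.
  by move=> si; have /= lin := s0n0 i si; split=> //; apply/Ds.
(* The fusion speaks only of bounds [k.+1] with [k] in the set. Hence [n] is not [n0 + j] itself but
   one past the last element of [D] in between, or [n0] if there is none. *)
have claim j : exists n, [/\ (n0 <= n <= n0 + j)%N, cut n = cut (n0 + j)%N,
    rej n (cut n) D0 & Q n (cut n) D].
  elim: j => [|j [n [/andP[n0n nj] cutE rn Qn]]].
    exists n0; rewrite addn0 leqnn cutn0; split=> // rn m Dm n0m.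
    exact: (QD1 rn _ (D2D1 _ (DB m n0m Dm))).
  set k := (n0 + j)%N in nj cutE *; rewrite addnS -/k.
  have cutS i : D i -> (i < k.+1)%N -> i <> k -> cut k i.
    by move=> Di ik /eqP nik; split=> //=; rewrite ltn_neqAle nik.
  have [Dk|nDk] := pselect (D k); last first.
    exists n; split=> //; first by lia.
    rewrite cutE; apply/seteqP; split=> i [Di /= ik]; first by split=> //=; lia.
    by apply: cutS => // ik'; apply: nDk; rewrite -ik'.
  have cutk : cut k `|` [set k] = cut k.+1.
    apply/seteqP; split=> i; first by move=> [[Di /= ik]|->] //; split=> //=; lia.
    by move=> [Di /= ik]; have [->|/eqP ik'] := eqVneq i k; [right|left; exact: cutS].
  exists k.+1; split=> //; first by lia.
    by rewrite -cutk -cutE; apply: Qn.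
  move=> rk m Dm km; have D2k := DB k (leq_addr _ _) Dk.
  apply: (QD2 k (cut k.+1)) => //; first by move=> i [].
  by split=> //; apply: DB => //; lia.
(* Openness at [D] makes the tail of [D] from [n0 + n] on accept the stem [cut p], which [D0]
   rejects. *)
have [n RDn] := R_open HD RD.
have [p [/andP[n0p pn] cutE rp _]] := claim n.
set k := (n0 + n)%N in pn cutE.
apply: (rp (tail k D)) => [||E [HE Es EB]].
- by move=> i [Di ki]; apply/D1D0/D2D1/DB => //; lia.
- exact: H_tail.
have Dcut i : D i -> (i < k)%N -> (i < p)%N.
  by move=> Di ik; have : cut k i by []; rewrite -cutE => -[].
apply: RDn; split=> // i.
  move=> lin; case: (leqP p i) => pi.
    split=> [Ei|Di]; first by have [] := EB i pi Ei.
    have /= := Dcut i Di; lia.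
  by split=> [/(Es i pi)[]//|Di]; apply/(Es i pi).
case: (leqP p i) => pi ni Ei; first by have [] := EB i pi Ei.
by have [] := (Es i pi).1 Ei.
Qed.

End OpenRamsey.

(** At stage [m] the fusion has to avoid only [N 0], ..., [N m]. A given [D] and [k] are handled at
    an element [m] of [D] above [k], with stem the part of [D] up to [m]. *)
Lemma meager_avoid (N : nat -> set (set nat)) :
  (forall k n (s B : set nat), s `<=` `I_n -> H B ->
     exists C, [/\ C `<=` B, H C & nbhd_cond n s C `<=` ~` N k]) ->
  forall n (s : set nat) S, s `<=` `I_n -> H S ->
  exists C, [/\ C `<=` S, H C & nbhd_cond n s C `<=` ~` \bigcup_k N k].
Proof.
move=> Nnd n s S sn HS.
have [C [CS HC PC]] : exists C, [/\ C `<=` S, H C & forall n (s : set nat), C n ->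
    s `<=` `I_n.+1 -> forall k, (k < n.+1)%N ->
    nbhd_cond n.+1 s (tail n.+1 C) `<=` ~` N k].
  apply: (fusion (P := fun n s B => forall k, (k < n)%N -> nbhd_cond n s B `<=` ~` N k)) => //.
    by move=> p t B C PB CB HC k kp D /(nbhd_condS CB)/PB; apply.
  move=> p t B tp BS HB.
  suff gen m : exists C, [/\ C `<=` B, H C &
    forall k, (k < m)%N -> nbhd_cond p t C `<=` ~` N k] by exact: gen.
  elim: m => [|m [C [CB HC PC]]]; first by exists B; split.
  have [E [EC HE PE]] := Nnd m p t C tp HC.
  exists E; split=> // [|k]; first exact: subset_trans CB.
  rewrite ltnS leq_eqVlt => /orP[/eqP->//|/PC km].
  exact: subset_trans (nbhd_condS EC) km.
exists C; split=> // D [HD Ds DC] [k _ NkD].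
have [m] := H_unbounded HD (maxn n k); rewrite geq_max => /andP[nm km] Dm.
have sub : D `&` `I_m.+1 `<=` `I_m.+1 by move=> i [].
apply: (PC m _ (DC m nm Dm) sub k) NkD => //.
split=> // i im; first by split=> [|[]].
by move=> Di; split=> //; apply: DC => //; lia.
Qed.
End SelectiveCoideal.

(** * Omega-covers and the coideal of their indices *)

Section OmegaCovers.
Variable X : topologicalType.
Implicit Types (U V A : set (set X)).

(** The covering clause is the case of singletons in the clause on finite sets. *)
Lemma omega_coverP U : omega_cover U <->
  [/\ forall u, U u -> open u, ~ U setT &
      forall F, finite_set F -> exists2 u, U u & F `<=` u].
Proof.
split=> [[[Uo _] [UT UF]]//|[Uo UT UF]]; split=> //; split=> //.
apply/seteqP; split=> // x _; have [u Uu xu] := UF _ (finite_set1 x).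
by exists u => //; exact: xu.
Qed.

Lemma omega_cover_open U u : omega_cover U -> U u -> open u.
Proof. by move=> [[Uo _] _]; exact: Uo. Qed.

Lemma omega_cover_neqT U u : omega_cover U -> U u -> exists x, ~ u x.
Proof.
move=> [_ [UT _]] Uu; apply/existsNP => uT; apply: UT.
by have <- : u = setT by apply/seteqP; split.
Qed.

Lemma omega_cover_sub U V : omega_cover U -> omega_cover V ->
  forall W, V `<=` W -> W `<=` U -> omega_cover W.
Proof.
move=> /omega_coverP[Uo UT _] /omega_coverP[_ _ VF] W VW WU.
apply/omega_coverP; split=> [u /WU/Uo//|/WU//|F /VF[u Vu Fu]].
by exists u => //; exact: VW.
Qed.

(** If a finite [F] lies in no member of [U] and a finite [G] in none of [V], their union lies in no
    member of either. *)
Lemma omega_cover_setU U V : omega_cover (U `|` V) ->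
  omega_cover U \/ omega_cover V.
Proof.
move=> /omega_coverP[Wo WT WF]; apply: contrapT => /not_orP[nU nV].
have [F finF nUF] : exists2 F, finite_set F & forall u, U u -> ~ (F `<=` u).
  apply: contrapT => nF; apply/nU/omega_coverP; split.
  - by move=> u Uu; apply: Wo; left.
  - by move=> UT; apply: WT; left.
  move=> F finF; apply: contrapT => nFu; apply: nF; exists F => // u Uu Fu.
  by apply: nFu; exists u.
have [G finG nVG] : exists2 G, finite_set G & forall u, V u -> ~ (G `<=` u).
  apply: contrapT => nF; apply/nV/omega_coverP; split.
  - by move=> u Uu; apply: Wo; right.
  - by move=> UT; apply: WT; right.
  move=> G finG; apply: contrapT => nGu; apply: nF; exists G => // u Uu Gu.
  by apply: nGu; exists u.
have finFG : finite_set (F `|` G) by rewrite finite_setU.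
have [u [Uu|Vu] FGu] := WF _ finFG.
  by apply: (nUF u Uu) => x Fx; apply: FGu; left.
by apply: (nVG u Vu) => x Gx; apply: FGu; right.
Qed.

(** One missing point for each [u i] gives a finite set that no subset of any [u i] contains. *)
Lemma omega_cover_not_bounded U N (u : nat -> set X) :
  (forall i, (i < N)%N -> exists x, ~ u i x) -> omega_cover U ->
  ~ (forall w, U w -> exists2 i, (i < N)%N & w `<=` u i).
Proof.
move=> uT /omega_coverP[_ _ UF] Uu.
(* Values in [option X], because there may be no point to serve as default when [i] is at least
   [N]. *)
have /choice[p pP] : forall i, exists q : option X, (i < N)%N ->
    exists2 x, q = Some x & ~ u i x.
  move=> i; have [iN|iN] := ltnP i N; last by exists None.
  by have [x nux] := uT i iN; exists (Some x) => _; exists x.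
have finF : finite_set [set x | exists2 i, (i < N)%N & p i = Some x].
  have sub : [set x | exists2 i, (i < N)%N & p i = Some x] `<=`
      \bigcup_(i in `I_N) [set x | p i = Some x].
    by move=> x [i iN pix]; exists i.
  apply: sub_finite_set sub _.
  apply: bigcup_finite => // i _.
  case: (p i) => [y|]; last first.
    by apply: (@sub_finite_set _ _ set0) => // x.
  by apply: (@sub_finite_set _ _ [set y]) => // x [].
have [w Uw Fw] := UF _ finF.
have [i iN wui] := Uu w Uw; have [x px nux] := pP i iN.
by apply/nux/wui/Fw; exists i.
Qed.

Lemma omega_cover_infinite U : omega_cover U -> infinite_set U.
Proof.
move=> UO finU; have [n /card_esym/card_set_bijP] := (finite_setP _).1 finU.
move=> [u [uU _ uonto]].
apply: (@omega_cover_not_bounded U n u) => // [i iN|w Uw].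
  by apply: omega_cover_neqT UO _; exact: uU.
by have [i iN <-] := uonto w Uw; exists i.
Qed.

Lemma ctsub_omega A (B : set (set X)) : countable A -> B `<=` A -> omega_cover B -> ctsub A B.
Proof.
move=> cA BA BO; split=> //; split; last exact: omega_cover_infinite.
exact: (sub_countable (subset_card_le BA)).
Qed.

Lemma omega_enum A : countable A -> omega_cover A -> exists e : nat -> set X, enum_of e A.
Proof.
move=> cA AO; have infA := omega_cover_infinite AO.
have /card_esym/card_set_bijP[e [eA einj eonto]] : A #= [set: nat].
  by rewrite eq_card_nat.
exists e; split; first by move=> i j; apply: einj; exact: mem_set.
apply/seteqP; split=> [w [i _ <-]|w /eonto[i _ <-]]; first exact: eA.
by exists i.
Qed.

Section Enumerated.
Variables (A : set (set X)) (e : nat -> set X).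
Hypothesis AO : omega_cover A.
Hypothesis eA : enum_of e A.

Definition omega_idx : set (set nat) := [set D | omega_cover (e @` D)].

Lemma enum_of_mem i : A (e i).
Proof. by case: eA => _ <-; exists i. Qed.

Lemma enum_countable : countable A.
Proof. by case: eA => _ <-; apply: sub_countable (card_image_le _ _) _. Qed.

Lemma image_enum_sub D : e @` D `<=` A.
Proof. by move=> _ [i _ <-]; exact: enum_of_mem. Qed.

Lemma ctsub_image D : omega_idx D -> ctsub A (e @` D).
Proof. by apply: ctsub_omega => //; [exact: enum_countable|exact: image_enum_sub]. Qed.

Lemma enum_preimageK (B : set (set X)) : B `<=` A -> e @` (e @^-1` B) = B.
Proof.
case: eA => _ rA BA; apply/seteqP; split=> [_ [i Bi <-]//|b Bb].
by have := BA b Bb; rewrite -rA => -[i _ ib]; exists i; rewrite /= ib.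
Qed.

Lemma enum_imageP D i : (e @` D) (e i) <-> D i.
Proof. by case: eA => einj _; split=> [[j Dj /einj<-]//|Di]; exists i. Qed.

Lemma omega_idx_up B C : omega_idx B -> B `<=` C -> omega_idx C.
Proof.
move=> BO BC; apply: omega_cover_sub AO BO _ _ _.
  exact: image_subset.
exact: image_enum_sub.
Qed.

Lemma omega_idx_setU B C : omega_idx (B `|` C) -> omega_idx B \/ omega_idx C.
Proof. by rewrite /omega_idx /= image_setU; exact: omega_cover_setU. Qed.

Lemma omega_idx_unbounded B : omega_idx B -> forall n, exists2 i, (n <= i)%N & B i.
Proof.
move=> BO n; apply: contrapT => nB; apply: (omega_cover_infinite BO).
apply: finite_image; apply: sub_finite_set (finite_II n) => i Bi /=.
by rewrite ltnNge; apply/negP => ni; apply: nB; exists i.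
Qed.

Hypothesis S1X : S1 (@Omega X) (@Omega X).

(* The n-th cover consists of the intersections of n+1 members from distinct blocks, so
   that one of them avoids the blocks of the n members selected before. *)
Lemma S1_distinct_blocks (b : nat -> nat) C :
  (forall n, exists N, forall i, (N <= i)%N -> (n <= b i)%N) -> omega_idx C ->
  exists D, [/\ D `<=` C, omega_idx D & forall i j, D i -> D j -> b i = b j -> i = j].
Proof.
move=> bfin CO.
pose good n (l : seq nat) := [/\ size l = n, uniq (map b l) & forall i, i \in l -> C i].
pose meet (l : seq nat) : set X := [set x | forall i, i \in l -> e i x].
have good_ex n F : finite_set F -> exists l, good n l /\ F `<=` meet l.
  move=> finF; elim: n => [|n [l [[sl ul lC] Fl]]]; first by exists [::].
  (* From [N] on, every block number exceeds those occurring in [l], so any index there may be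
     adjoined. *)
  have [N NP] := bfin (\max_(i <- l) b i).+1.
  have CNO : omega_idx (tail N C).
    by apply: H_tail CO; [exact: omega_idx_up|exact: omega_idx_setU|exact: omega_idx_unbounded].
  have /omega_coverP[_ _ /(_ F finF)[_ [i [Ci Ni] <-] Fi]] := CNO.
  exists (i :: l); split; last first.
    by move=> x Fx j; rewrite inE => /orP[/eqP->|jl]; [exact: Fi|exact: Fl].
  split=> /=; first by rewrite sl.
    rewrite ul andbT; apply/mapP => -[j jl bij].
    by have := NP i Ni; rewrite bij ltnNge leq_bigmax_seq.
  by move=> j; rewrite inE => /orP[/eqP->//|]; exact: lC.
pose W n := [set w | exists l, good n.+1 l /\ w = meet l].
have WO n : omega_cover (W n).
  apply/omega_coverP; split.
  - move=> _ [l [[_ _ _] ->]]; elim: l => [|i l IH].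
      rewrite (_ : meet [::] = setT); first exact: openT.
      by apply/seteqP; split.
    rewrite (_ : meet (i :: l) = e i `&` meet l).
      by apply: openI => //; apply: omega_cover_open AO (enum_of_mem i).
    apply/seteqP; split=> x.
      by move=> il; split=> [|j jl]; apply: il; rewrite inE ?eqxx ?jl ?orbT.
    by move=> [ix lx] j; rewrite inE => /orP[/eqP->|/lx].
  - move=> [[|i l] [[]//= _ _ _ mT]].
    have [x] := omega_cover_neqT AO (enum_of_mem i); apply.
    have : meet (i :: l) x by rewrite -mT.
    by apply; rewrite inE eqxx.
  - move=> F /(good_ex n.+1)[l [gl Fl]].
    by exists (meet l) => //; exists l.
have [T [TW TO]] := S1X WO.
have /choice[l lP] := TW.
(* The indices in [l n] occupy [n.+1] blocks, those in [p n] only [n]; hence the filtered list is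
   nonempty and the default 0 is never taken. *)
pose pick n (p : seq nat) := head 0%N [seq i <- l n | b i \notin map b p].
pose p := fix p n := if n is k.+1 then rcons (p k) (pick k (p k)) else [::].
have sp n : size (p n) = n by elim: n => //= n IH; rewrite size_rcons IH.
have pickP n : pick n (p n) \in l n /\ b (pick n (p n)) \notin map b (p n).
  have [[sl ul lC] _] := lP n.
  suff : pick n (p n) \in [seq i <- l n | b i \notin map b (p n)].
    by rewrite mem_filter => /andP[].
  rewrite /pick; case E : [seq i <- l n | _] => [|i s] /=; last by rewrite inE eqxx.
  have : (size (map b (l n)) <= size (map b (p n)))%N.
    apply: uniq_leq_size => // _ /mapP[i il ->]; apply: contraT => nbi.
    have : i \in [seq i <- l n | b i \notin map b (p n)] by rewrite mem_filter nbi.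
    by rewrite E.
  by rewrite !size_map sl sp ltnn.
pose v n := pick n (p n).
have p_mem n m : (n < m)%N -> v n \in p m.
  elim: m => // m IH; rewrite ltnS leq_eqVlt mem_rcons inE => /orP[/eqP->|/IH->].
    by rewrite eqxx.
  by rewrite orbT.
have bv n m : (n < m)%N -> b (v n) <> b (v m).
  move=> nm bnm; have [_] := pickP m; rewrite -/(v m) -bnm => /mapP; apply.
  by exists (v n) => //; exact: p_mem.
exists (range v); split.
- by move=> _ [n _ <-]; have [[_ _ +] _] := lP n; apply; case: (pickP n).
- apply/omega_coverP; split.
  + by move=> _ [i _ <-]; apply: omega_cover_open AO (enum_of_mem i).
  + by move=> [i _ ei]; case: AO => _ [+ _]; apply; rewrite -ei; exact: enum_of_mem.
  + move=> F finF; have /omega_coverP[_ _ /(_ F finF)[_ [n _ <-] Fn]] := TO.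
    exists (e (v n)); first by exists (v n) => //; exists n.
    move=> x /Fn; have [_ ->] := lP n; apply.
    by case: (pickP n).
- move=> _ _ [n _ <-] [m _ <-] bnm.
  by case: (ltngtP n m) => [/bv//|/bv/(_ (esym bnm))//|->].
Qed.

Lemma block_function (m : nat -> nat) : m 0%N = 0%N ->
  (forall j, (m j < m j.+1)%N) ->
  exists b : nat -> nat, forall i, (m (b i) <= i < m (b i).+1)%N.
Proof.
move=> m0 ms.
suff /choice[b bP] : forall i, exists j, (m j <= i < m j.+1)%N by exists b.
elim=> [|i [j /andP[ji ij]]].
  by exists 0%N; have := ms 0%N; rewrite m0.
have [ij'|ij'] := ltnP i.+1 (m j.+1); first by exists j; rewrite (leqW ji) ij'.
by exists j.+1; rewrite ij' (leq_ltn_trans ij).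
Qed.

Lemma omega_idx_selective (B : nat -> set nat) :
  (forall n, omega_idx (B n)) -> (forall n, B n.+1 `<=` B n) ->
  exists D, [/\ omega_idx D, D `<=` B 0%N &
    forall n m, D n -> D m -> (n < m)%N -> B n m].
Proof.
move=> BO Bdec.
have Bmono n m : (n <= m)%N -> B m `<=` B n.
  elim: m => [|m IH]; first by rewrite leqn0 => /eqP->.
  by rewrite leq_eqVlt => /orP[/eqP->//|/IH BmBn]; exact: subset_trans BmBn.
have [T [TB TO]] := S1X BO.
have /choice[c cP] : forall n, exists i, B n i /\ T n = e i.
  by move=> n; have [i Bi ei] := TB n; exists i.
have CO : omega_idx (range c).
  rewrite /omega_idx /= (_ : e @` range c = range T) //.
  apply/seteqP; split=> [_ [_ [n _ <-] <-]|_ [n _ <-]].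
    by exists n => //; case: (cP n).
  by exists (c n); [exists n|case: (cP n)].
(* An element of [range c] that is at least [g k] is no [c j] with [j < k], hence lies in [B k]. The
   summand [k] makes the iterates of [g] strictly increase. *)
pose g k := (\max_(j < k) c j + k).+1.
have gP k i : range c i -> (g k <= i)%N -> B k i.
  move=> [j _ <-]; have [jk|kj] := ltnP j k; last first.
    by move=> _; apply: (Bmono k j kj); case: (cP j).
  have cj : (c j <= \max_(i < k) c i)%N.
    exact: (@leq_bigmax 'I_k (fun i => c i) (Ordinal jk)).
  by rewrite /g ltnNge (leq_trans cj) ?leq_addr.
pose m := fix m j := if j is j'.+1 then g (m j') else 0%N.
have mlt j : (m j < m j.+1)%N by rewrite /= /g ltnS leq_addl.
have [b bP] := @block_function m erefl mlt.
have mmono j k : (j <= k)%N -> (m j <= m k)%N.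
  elim: k => [|k IH]; first by rewrite leqn0 => /eqP->.
  by rewrite leq_eqVlt => /orP[/eqP->//|/IH mk]; exact: leq_trans mk (ltnW (mlt k)).
have b_ge n i : (m n <= i)%N -> (n <= b i)%N.
  move=> ni; rewrite leqNgt; apply/negP => /mmono.
  by have := bP i; lia.
have [D [DC DO Dinj]] : exists D, [/\ D `<=` range c, omega_idx D &
    forall i j, D i -> D j -> b i = b j -> i = j].
  apply: S1_distinct_blocks => // n; exists (m n); exact: b_ge.
(* Two elements in distinct blocks of equal parity have a full block between them, so the larger is
   at least [g] of the end of the smaller one's block. *)
suff [E [ED EO Epar]] : exists E, [/\ E `<=` D, omega_idx E &
    forall i j, E i -> E j -> odd (b i) = odd (b j)].
  exists E; split=> // [i /ED/DC[j _ <-]|i j Ei Ej ij].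
    by apply: (Bmono 0%N j); [lia|case: (cP j)].
  have bij : (b i < b j)%N.
    have : b i <> b j by move=> /(Dinj _ _ (ED _ Ei) (ED _ Ej)); lia.
    suff : (b i <= b j)%N by lia.
    by apply: b_ge; have := bP i; lia.
  have bij2 : ((b i).+2 <= b j)%N by have := Epar i j Ei Ej; lia.
  apply: (Bmono i (m (b i).+1)); first by have := bP i; lia.
  apply: gP; first by apply/DC/ED.
  by have /= := mmono _ _ bij2; have := bP j; lia.
have [EO|EO] : omega_idx [set i | D i /\ odd (b i)] \/ omega_idx [set i | D i /\ ~~ odd (b i)].
  apply: omega_idx_setU; apply: omega_idx_up DO _ => i Di.
  by have [?|?] := boolP (odd (b i)); [left|right].
  by exists [set i | D i /\ odd (b i)]; split=> // [i []//|i j /= [_ ->] [_ ->]].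
exists [set i | D i /\ ~~ odd (b i)]; split=> // [i []//|i j /= [_ /negPf->] [_ /negPf->]] //.
Qed.

End Enumerated.
End OmegaCovers.

(** * From S1 to the Ellentuck and Galvin-Prikry properties *)

Section EllentuckTransfer.
Variable X : topologicalType.
Variables (A : set (set X)) (e : nat -> set X).
Hypothesis AO : omega_cover A.
Hypothesis eA : enum_of e A.

Lemma enum_bound (s : set (set X)) : finite_set s ->
  exists n, e @^-1` s `<=` `I_n.
Proof.
case: eA => einj _ fins.
have /finite_seqP[l lE] : finite_set (e @^-1` s).
  by apply: finite_preimage fins => i j _ _; exact: einj.
exists (\max_(i <- l) i).+1 => i; rewrite lE /= => il.
by rewrite ltnS leq_bigmax_seq.
Qed.

Lemma enum_case a : A a -> exists i, a = e i.
Proof. by case: eA => _ <- [i _ <-]; exists i. Qed.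

Lemma ell_basic_nbhd_cond n (s : set (set X)) B D : e @^-1` s `<=` `I_n ->
  (forall i, B i -> (n <= i)%N) -> (ell_basic e A s (e @` B) `&` @Omega X) D ->
  nbhd_cond (omega_idx e) n (e @^-1` s) B (e @^-1` D).
Proof.
move=> sn Bn [[[DA _] [C [DE [sC CB]]]] DO]; split.
- by rewrite /omega_idx /= (enum_preimageK eA DA).
- move=> i lin; split=> [/=|si]; last by rewrite /= DE; left.
  rewrite DE => -[//|/CB/(enum_imageP eA)/Bn]; by rewrite leqNgt lin.
- move=> i ni /=; rewrite DE => -[/sn/=|/CB/(enum_imageP eA)//].
  by rewrite ltnNge ni.
Qed.

Lemma nbhd_cond_ell_basic n (s D : set nat) B : s `<=` `I_n ->
  nbhd_cond (omega_idx e) n s B D -> ell_basic e A (e @` s) (e @` B) (e @` D).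
Proof.
move=> sn [DO Ds DB]; split.
  exact: (ctsub_image eA).
exists (e @` (D `\` s)); split; last split.
- rewrite -image_setU; congr (e @` _); apply/seteqP; split=> i.
    by move=> Di; have [si|nsi] := pselect (s i); [left|right].
  by move=> [si|[]//]; apply/Ds => //; exact: sn.
- move=> i j /(enum_imageP eA)/sn/= lin /(enum_imageP eA)[Dj nsj].
  apply: leq_trans lin _; rewrite leqNgt; apply/negP => jn.
  by apply/nsj/Ds.
- apply: image_subset => i [Di nsi]; apply: DB => //.
  by rewrite leqNgt; apply/negP => lin; apply/nsi/Ds.
Qed.

Lemma ell_basic_open (s B : set (set X)) : finsub A s -> B `<=` A -> infinite_set B ->
  ell_open e A (ell_basic e A s B).
Proof.
move=> sA BA Binf; split=> [D []//|D DsB].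
by exists s, B; split=> //; split=> //; split=> //; split.
Qed.

(** Let [s,B] be a neighbourhood of [D] and let [n] bound s. A set that agrees with [D] below [n]
    and stays inside [D] beyond contains s and draws its other elements from [B]. *)
Lemma ell_open_idx (U : set (set (set X))) :
  sub_open (ell_open e A) (ctsub A `&` @Omega X) U ->
  ell_nbhd_open (omega_idx e) [set D | U (e @` D)].
Proof.
move=> [V [[_ Vop] ->]] D DO [VD [DA _]].
have [s [B [[sA fins] [BA [Binf [[_ [C [DE [sC CB]]]] sBV]]]]]] := Vop _ VD.
have [n sn] := enum_bound fins.
exists n => E [EO ED EsubD] /=.
have Ect : ctsub A (e @` E).
  exact: (ctsub_image eA).
split=> //; apply: sBV; split=> //.
have EDsub : e @` E `<=` e @` D.
  move=> _ [i Ei <-]; exists i => //.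
  by have [/ED[]|ni] := ltnP i n; [move=> + _; apply|exact: EsubD].
exists (e @` E `\` s); split; last split.
- apply/seteqP; split=> a; first by move=> Ea; have [|] := pselect (s a); [left|right].
  move=> [sa|[]//]; have [i aE] := enum_case (sA a sa).
  have /= lin : i \in `I_n by apply/mem_set/sn; rewrite /= -aE.
  have : (e @` D) a by rewrite DE; left.
  rewrite aE => /(enum_imageP eA) Di; apply/(enum_imageP eA).
  by apply/ED => //; apply: sn; rewrite /= -aE.
- by move=> i j si [/EDsub + nsj]; rewrite DE => -[//|]; exact: sC.
- by move=> a [/EDsub + nsa]; rewrite DE => -[//|]; exact: CB.
Qed.

Hypothesis S1X : S1 (@Omega X) (@Omega X).

Let H := omega_idx e.
Let H_up := @omega_idx_up X A e AO eA.
Let H_setU := @omega_idx_setU X e.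
Let H_unb := @omega_idx_unbounded X e.
Let H_sel := @omega_idx_selective X A e AO eA S1X.

(** The complement of the closure of [N] is open, hence decided by some condition. If the condition
    lay in the closure, it would be a nonempty open set there, with the stem plus a tail of the
    reservoir as a member. *)
Lemma nowhere_dense_avoid (N : set (set (set X))) :
  sub_nowhere_dense (ell_open e A) (ctsub A `&` @Omega X) N ->
  forall n (s B : set nat), s `<=` `I_n -> H B ->
  exists C, [/\ C `<=` B, H C &
    nbhd_cond H n s C `<=` ~` [set D | N (e @` D)]].
Proof.
set Y := ctsub A `&` @Omega X; move=> [NY Nint] n s B sn HB.
pose cl := sub_closure (ell_open e A) Y N.
have idxY D : H D -> Y (e @` D).
  by move=> DO; split=> //; exact: (ctsub_image eA).
have cl_open : ell_nbhd_open H [set D | H D /\ ~ cl (e @` D)].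
  move=> D HD [_ nclD].
  have [W [Wop WD WN]] : exists W, [/\ sub_open (ell_open e A) Y W, W (e @` D) &
      ~ (W `&` N !=set0)].
    apply: contrapT => nW; apply: nclD; split=> [|W Wop WD]; first exact: idxY.
    by apply: contrapT => WN; apply: nW; exists W.
  have [p pW] := ell_open_idx Wop HD WD.
  exists p => E DE; have [HE _ _] := DE; split=> // -[_ /(_ W Wop)].
  by move=> /(_ (pW _ DE)).
have [C [CB HC [CK|CnK]]] := open_ramsey H_up H_setU H_unb H_sel cl_open sn HB.
  exists C; split=> // D /CK[HD nclD] ND; apply: nclD; split; first exact: NY.
  by move=> W _ WD; exists (e @` D).
have Ctail : H (tail n C) by exact: H_tail.
have D0 := nbhd_cond0 H_up H_setU H_unb sn HC.
exfalso; suff : sub_interior (ell_open e A) Y cl (e @` (s `|` tail n C)) by rewrite Nint.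
exists (ell_basic e A (e @` s) (e @` tail n C) `&` Y); split; last split.
- exists (ell_basic e A (e @` s) (e @` tail n C)); split=> //.
  apply: ell_basic_open.
  + split; first exact: (@image_enum_sub _ _ _ eA).
    by apply: finite_image; apply: sub_finite_set sn _; exact: finite_II.
  + exact: (@image_enum_sub _ _ _ eA).
  + exact: omega_cover_infinite Ctail.
- split; last by apply: idxY; case: D0.
  by apply: nbhd_cond_ell_basic sn _; exact: nbhd_cond_tail.
- move=> D [Dbasic [[DA Dct] DO]].
  have sE : e @^-1` (e @` s) = s by apply/seteqP; split=> i /(enum_imageP eA).
  have Dn : nbhd_cond H n s C (e @^-1` D).
    have : nbhd_cond H n s (tail n C) (e @^-1` D).
      rewrite -{1}sE; apply: ell_basic_nbhd_cond; rewrite ?sE //.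
      by move=> i [].
    by apply: nbhd_condS => i [].
  have := CnK _ Dn; rewrite /= => nK; apply: contrapT => nclD; apply: nK.
  by rewrite (enum_preimageK eA DA); split=> //; case: Dn.
Qed.

(** The reservoir is shrunk first to avoid the meager set, then to decide the open set; on what is
    left, [R] and the open set agree. Starting from a tail of [S] keeps the reservoir beyond [s]. *)
Lemma ellentuck_baire (R : set (set (set X))) :
  sub_baire (ell_open e A) (ctsub A `&` @Omega X) R ->
  forall S, S `<=` A -> @Omega X S -> forall s, finsub A s ->
  exists B, B `<=` restr e S s /\ infinite_set B /\ @Omega X B /\
    (ell_basic e A s B `&` @Omega X `<=` R \/
     ell_basic e A s B `&` @Omega X `&` R = set0).
Proof.
move=> [U [M [Uop [[N [Nnd ->]] RE]]]] S SA SO s [sA fins].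
have [n sn] := enum_bound fins.
have HS : H (tail n (e @^-1` S)).
  by apply: H_tail => //; rewrite /H /omega_idx /= (enum_preimageK eA SA).
have [B1 [B1S HB1 B1M]] := meager_avoid H_up H_setU H_unb H_sel
  (fun k => nowhere_dense_avoid (Nnd k)) sn HS.
have [B [BB1 HB dB]] := open_ramsey H_up H_setU H_unb H_sel (ell_open_idx Uop) sn HB1.
have Bn i : B i -> (n <= i)%N by move=> /BB1/B1S[].
have key D : (ell_basic e A s (e @` B) `&` @Omega X) D ->
    nbhd_cond H n (e @^-1` s) B (e @^-1` D) /\ ~ (\bigcup_k N k) D.
  move=> DB; have Dn := ell_basic_nbhd_cond sn Bn DB; split=> // -[k _ ND].
  apply: (B1M _ (nbhd_condS BB1 Dn)); exists k => //=.
  by have [[[DA _] _] _] := DB; rewrite (enum_preimageK eA DA).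
have DE D : (ell_basic e A s (e @` B) `&` @Omega X) D -> e @` (e @^-1` D) = D.
  by move=> [[[DA _] _] _]; exact: (enum_preimageK eA DA).
exists (e @` B); split; last split; last split.
- move=> _ [i Bi <-]; split; first by have [] := B1S _ (BB1 _ Bi).
  move=> j k /sn/= jn; case: eA => einj _ /einj ->.
  exact: leq_trans jn (Bn i Bi).
- exact: omega_cover_infinite HB.
- exact: HB.
case: dB => dB; [left|right].
  move=> D DB; have [Dn nM] := key D DB; rewrite RE; left; split=> //.
  by have := dB _ Dn; rewrite /= (DE D DB).
rewrite -subset0 => D [DB]; have [Dn nM] := key D DB; rewrite RE => -[[UD _]|[//]].
by have := dB _ Dn; rewrite /= (DE D DB).
Qed.
End EllentuckTransfer.

Section Equivalences.
Variable X : topologicalType.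

Lemma S1_E : S1 (@Omega X) (@Omega X) -> E_OO X.
Proof.
move=> S1X A e [AO _] eA R _ Rb S SA SO s sA.
exact: (ellentuck_baire AO eA S1X Rb SA SO sA).
Qed.

(** The stem is the part of [D] below a bound for [F], the reservoir the rest of [D]: every set in
    this neighbourhood contains [F] and, being a subset of [D], misses [G]. *)
Lemma cantor_open_ell_open A e (U : set (set (set X))) : enum_of e A ->
  cantor_open A U -> ell_open e A (U `&` (ctsub A)).
Proof.
move=> eA [UA Uop]; split=> [D []//|D [UD Dct]].
have [F [G [finF [finG [FD [GD FGU]]]]]] := Uop D UD.
have [n Fn] := enum_bound eA finF.
have DA := UA D UD.
pose s := D `&` e @` `I_n; exists s, (D `\` s).
have fins : finite_set s by apply: finite_setIr; apply: finite_image; exact: finite_II.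
have sD : s `<=` D by move=> a [].
have elts : elt e s (D `\` s).
  move=> i j [_ /(enum_imageP eA)/= lin] [Dj nsj].
  apply: leq_trans lin _; rewrite leqNgt; apply/negP => jn.
  by apply: nsj; split.
split; first by split=> //; exact: subset_trans DA.
split; first by move=> a [/DA].
split; first by apply: infinite_setD => //; case: Dct => _ [].
split; first by split=> //; exists (D `\` s); split; [rewrite setDUK|split=> // a []].
move=> E [Ect [C [EE [sC CD]]]]; split=> //; apply: FGU; split; last split.
- by case: Ect.
- move=> a Fa; rewrite EE; left; split; first exact: FD.
  have [i aE] := enum_case eA (DA a (FD a Fa)).
  by rewrite aE; exists i => //; apply: Fn; rewrite /= -aE.
- rewrite -subset0 => a [Ga]; rewrite EE => -[/sD Da|/CD[Da _]];
    by rewrite -GD.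
Qed.

Lemma sub_nowhere_dense0 (Z : Type) (op : set Z -> Prop) Y : sub_nowhere_dense op Y set0.
Proof.
split=> //; rewrite -subset0 => y [W [Wop [Wy Wcl]]].
by have [_ /(_ W Wop Wy)[z []]] := Wcl y Wy.
Qed.

(** An open set has the Baire property with empty meager part, and the empty stem turns the basic
    set into all infinite subsets of [B]. *)
Lemma E_GP : E_OO X -> GP_OO X.
Proof.
move=> EX A [AO [cA Ainf]] R RY [U [Uop RE]] S [[SA Sct] SO].
have [e eA] := omega_enum cA AO.
have Rb : sub_baire (ell_open e A) (ctsub A `&` @Omega X) R.
  exists R, set0; split; last split.
  - exists (U `&` ctsub A); split; first exact: cantor_open_ell_open.
    by rewrite RE; apply/seteqP; split=> D; [move=> [UD [? ?]]|move=> [[? ?] ?]].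
  - exists (fun=> set0); split=> [_|]; first exact: sub_nowhere_dense0.
    by rewrite bigcup0.
  - by rewrite setD0 set0D setU0.
have fin0 : finsub A set0 by split.
have [B [BS [Binf [BO dB]]]] := EX A e (conj AO (conj cA Ainf)) eA R RY Rb S SA SO _ fin0.
have BS' : B `<=` S by move=> a /BS[].
have cS : countable S by case: Sct.
exists B; split; first by split=> //; exact: ctsub_omega.
have sub D : (ctsub B `&` @Omega X) D -> (ell_basic e A set0 B `&` @Omega X) D.
  move=> [[DB Dct] DO]; split=> //; split.
    by split=> // a /DB/BS'/SA.
  by exists D; rewrite set0U; split=> //; split=> // i j [].
case: dB => dB; [left=> D /sub/dB //|right].
by rewrite -subset0 => D [/sub DB RD]; rewrite -dB.
Qed.
End Equivalences.

(** * Small finite subsets *)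

Lemma card_eq_sub T (s t : set T) n : s `<=` t -> s #= `I_n -> t #= `I_n -> s = t.
Proof.
(* Finite sets of type [fset] require a choice structure on [T]. *)
elim/Pchoice: T s t => T s t st sn tn.
have fins : finite_set s by apply/finite_setP; exists n.
have fint : finite_set t by apply/finite_setP; exists n.
apply: fset_set_inj => //; apply/eqP.
rewrite eqEfcard (card_fset_set sn) (card_fset_set tn) leqnn andbT.
by rewrite -fset_set_sub.
Qed.

Lemma msub_set2 T (V : set T) a b : V a -> V b -> a <> b -> msub V 2 [set a; b].
Proof.
move=> Va Vb ab; split; first by move=> x [->|->].
apply/eq_cardSP; exists a; first by left.
rewrite (_ : _ `\ a = [set b]) ?card_set1 //.
apply/seteqP; split=> [x [[xa|//] nxa]|x ->]; first by case: nxa.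
by split; [right|exact: nesym].
Qed.

Lemma msub_set3 T (V : set T) a b c : V a -> V b -> V c ->
  a <> b -> a <> c -> b <> c -> msub V 3 [set a; b; c].
Proof.
move=> Va Vb Vc ab ac bc; split; first by move=> x [[->|->]|->].
apply/eq_cardSP; exists c; first by right.
rewrite (_ : _ `\ c = [set a; b]); first by case: (msub_set2 Va Vb ab).
apply/seteqP; split=> [x [[//|xc] nxc]|x [->|->]]; first by case: nxc.
  by split=> //; left; left.
by split=> //; left; right.
Qed.

(** * Initial segments and partition relations *)

Section InitialSegments.
Variable X : topologicalType.
Variables (A : set (set X)) (e : nat -> set X).
Hypothesis eA : enum_of e A.

(** Otherwise an element of [s] outside [t] and one of [t] outside [s] would each precede the
    other. *)
Lemma init_seg_total s t C : C `<=` A -> init_seg e s C -> init_seg e t C ->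
  s `<=` t \/ t `<=` s.
Proof.
move=> CA [_ [sC sI]] [_ [tC tI]]; apply: contrapT => /not_orP[].
move=> /existsNP[a /not_implyP[sa nta]] /existsNP[b /not_implyP[tb nsb]].
have [i aE] := enum_case eA (CA a (sC a sa)).
have [j bE] := enum_case eA (CA b (tC b tb)).
subst a b.
have ij : (i < j)%N by apply: sI sa _; split=> //; exact: tC.
have ji : (j < i)%N by apply: tI tb _; split=> //; exact: sC.
by lia.
Qed.

Lemma init_seg_sub s t C : init_seg e s C -> init_seg e t C -> s `<=` t ->
  init_seg e s t.
Proof.
move=> [fins [_ sI]] [_ [tC _]] st; split=> //; split=> // i j si [tj nsj].
by apply: sI => //; split=> //; exact: tC.
Qed.

Hypothesis AO : omega_cover A.

(** The members of [B] beyond [s] still form an omega-cover. This turns information on all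
    omega-subcovers of [B] into information on all its finite subsets. *)
Lemma init_seg_extend B s : (ctsub A `&` @Omega X) B -> finsub B s ->
  exists C, (ctsub B `&` @Omega X) C /\ init_seg e s C.
Proof.
move=> [[BA Bct] BO] [sB fins]; have [n sn] := enum_bound eA fins.
exists (s `|` restr e B s); split; last first.
  split=> //; split; first exact: subsetUl.
  by move=> i j si [[sj /(_ sj)//|[_ /(_ i j si) ij]] _]; exact: ij.
have CB : s `|` restr e B s `<=` B by move=> a [/sB|[]].
suff CO : omega_cover (s `|` restr e B s).
  by split=> //; apply: ctsub_omega => //; case: Bct.
have /= HB : omega_idx e (tail n (e @^-1` B)).
  apply: H_tail; [exact: omega_idx_up AO eA|exact: omega_idx_setU|exact: omega_idx_unbounded|].
  by rewrite /omega_idx /= (enum_preimageK eA BA).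
apply: (omega_cover_sub BO HB) => // _ [i [Bi ni] <-]; right; split=> //.
move=> j k /sn/= jn; case: eA => einj _ /einj ->.
exact: leq_trans jn ni.
Qed.

Lemma init_seg_cantor_open (Sf : set (set (set X))) : Sf `<=` finsub A ->
  cantor_open A [set D | D `<=` A /\ exists s, Sf s /\ init_seg e s D].
Proof.
move=> SfA; split=> [D []//|D [DA [s [Ss [fins [sD sI]]]]]].
have [n sn] := enum_bound eA fins.
(* To keep [s] initial, it is enough to forbid the finitely many elements enumerated before [n] that
   are not in [D]. *)
exists s, (e @` (`I_n `\` e @^-1` D)); split=> //; split.
  by apply: finite_image; apply: finite_setD; exact: finite_II.
split=> //; split.
  by rewrite -subset0 => _ [[i [_ nDi] <-]].
move=> E [EA [sE GE]]; split=> //; exists s; split=> //; split=> //; split=> //.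
move=> i j si [Ej nsj]; have [Dj|nDj] := pselect (D (e j)); first exact: sI.
have /= lin := sn i si; apply: leq_trans lin _; rewrite leqNgt; apply/negP => jn.
suff : (set0 : set (set X)) (e j) by [].
by rewrite -GE; split=> //; exists j.
Qed.

(** GP is applied to the open family of sets with an initial segment in [Sf]. In the negative case
    no [s] in [Sf] fits into [B], since it would continue inside [B] to an omega-cover of that
    family. *)
Lemma GP_init_seg (Sf : set (set (set X))) S : GP_OO X -> countable A ->
  Sf `<=` finsub A -> (ctsub A `&` @Omega X) S ->
  exists B, (ctsub S `&` @Omega X) B /\
    ((forall C, (ctsub B `&` @Omega X) C -> exists s, Sf s /\ init_seg e s C) \/
     (forall s, Sf s -> ~ s `<=` B)).
Proof.
move=> GPX cA SfA SA.
have Act : @ctOmega X A by split=> //; split=> //; exact: omega_cover_infinite.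
pose U := [set D | D `<=` A /\ exists s, Sf s /\ init_seg e s D].
have [B [BS dB]] := GPX A Act (U `&` (ctsub A `&` @Omega X)) (@subIsetr _ _ _)
  (ex_intro _ U (conj (init_seg_cantor_open SfA) erefl)) S SA.
exists B; split=> //; case: dB => dB; [left|right].
  by move=> C /dB[[_ ?] _].
move=> s Ss sB; have [_ fins] := SfA s Ss.
have BA : (ctsub A `&` @Omega X) B.
  by have [[BsubS Bct] BO] := BS; split=> //; split=> // a /BsubS; case: SA => -[+ _] _; exact.
have [C [CB sC]] := init_seg_extend BA (conj sB fins).
suff : (set0 : set (set (set X))) C by [].
rewrite -dB; split=> //; have [[CsubB Cct] CO] := CB; have [[BsubA _] _] := BA.
have CA : C `<=` A by exact: subset_trans BsubA.
by split=> //; split=> //; exists s.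
Qed.
End InitialSegments.

(** * From GP to FG, NW and the partition relations *)

Section Implications.
Variable X : topologicalType.

Lemma GP_FG : GP_OO X -> FG_OO X.
Proof.
move=> GPX A e [AO [cA Ainf]] eA Sf [SfA Sdense].
have AA : (ctsub A `&` @Omega X) A by split=> //; split.
have [B [BA [dB|dB]]] := GP_init_seg eA AO GPX cA SfA AA; first by exists B.
have [s [Ss [sB _]]] := Sdense B BA.
by case: (dB s Ss).
Qed.

(** The classes are treated one by one. If class [i] gives the positive alternative, a member of
    [Tf] inside [B] and a member of [Tp i] are initial segments of a common set, so they coincide by
    thinness. If every class gives the negative one, [B] contains no member of [Tf] and any class
    will do. *)
Lemma GP_NW : GP_OO X -> NW_OO X.
Proof.
move=> GPX A e [AO [cA Ainf]] eA Tf [TfA Tthin] n Tp n_gt0 TE _.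
have AA : (ctsub A `&` @Omega X) A by split=> //; split.
have gen m : (m <= n)%N -> exists B, (ctsub A `&` @Omega X) B /\
    ((exists i, (1 <= i <= n)%N /\ forall C, (ctsub B `&` @Omega X) C ->
       exists s, Tp i s /\ init_seg e s C) \/
     (forall i, (1 <= i <= m)%N -> forall s, Tp i s -> ~ s `<=` B)).
  elim: m => [|m IH] mn; first by exists A; split=> //; right=> i; lia.
  have [B [BA [dB|dB]]] := IH (ltnW mn); first by exists B; split=> //; left.
  have TpA : Tp m.+1 `<=` finsub A by move=> s Ts; apply: TfA; rewrite TE; exists m.+1.
  have [C [[[CB Cct] CO] dC]] := GP_init_seg eA AO GPX cA TpA BA.
  have CA : (ctsub A `&` @Omega X) C.
    by split=> //; split=> // a /CB; case: BA => -[+ _] _; exact.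
  exists C; split=> //; case: dC => dC; [left|right]; first by exists m.+1.
  move=> i /andP[i1]; rewrite leq_eqVlt => /orP[/eqP->//|im] s Ts sC.
  by apply: (dB i _ s Ts); [rewrite i1 | exact: subset_trans CB].
have [B [BA [[i [iin dB]]|dB]]] := gen n (leqnn n).
  exists B, i; split=> //; split=> // t [tB Tt].
  have [C [CB tC]] := init_seg_extend eA AO BA tB.
  have [s [Ts sC]] := dB C CB.
  have Ts' : Tf s by rewrite TE; exists i.
  have [[CsubB _] _] := CB; have [[BsubA _] _] := BA.
  suff -> : t = s by [].
  apply: contrapT => ts.
  have [st|st] := init_seg_total eA (subset_trans CsubB BsubA) sC tC.
    exact: (Tthin s t Ts' Tt (nesym ts) (init_seg_sub sC tC st)).
  exact: (Tthin t s Tt Ts' ts (init_seg_sub tC sC st)).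
exists B, 1%N; split=> //; split; first by lia.
move=> t [[tB _]]; rewrite TE => -[i iin Tt].
by case: (dB i iin t Tt).
Qed.

Hypothesis omega_lindelof : forall U : set (set X), omega_cover U ->
  exists V, V `<=` U /\ countable V /\ omega_cover V.

(** Let [Sf] be the pairs of colour 2. If [Sf] is dense, every pair in [B] starts some
    omega-subcover that also starts with a pair in [Sf], and two initial segments of equal size
    coincide. If not, some omega-subcover contains no pair of colour 2. *)
Lemma FG_arrow2 : FG_OO X -> arrow2 (@Omega X) (@Omega X) (@Ocov X) 2.
Proof.
move=> FGX U UO f f12; have [A [AU [cA AO]]] := omega_lindelof UO.
have [e eA] := omega_enum cA AO.
have Act : @ctOmega X A by split=> //; split=> //; exact: omega_cover_infinite.
pose Sf := [set s | msub A 2 s /\ f s = 2%N].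
have SfA : Sf `<=` finsub A.
  by move=> s [[sA s2] _]; split=> //; apply/finite_setP; exists 2%N.
have [Sdense|nSdense] := pselect (dense_fam A Sf).
  right; have [B [BA dB]] := FGX A e Act eA Sf Sdense.
  have [[BsubA _] BO] := BA.
  exists B; split; first exact: subset_trans AU.
  split; first by case: BO.
  move=> t [tB t2].
  have tfin : finite_set t by apply/finite_setP; exists 2%N.
  have [C [CB tC]] := init_seg_extend eA AO BA (conj tB tfin).
  have [s [[[_ s2] fs2] sC]] := dB C CB.
  have [[CsubB _] _] := CB.
  suff -> : t = s by [].
  have [st|ts] := init_seg_total eA (subset_trans CsubB BsubA) sC tC.
    exact/esym/(card_eq_sub st s2 t2).
  exact: card_eq_sub ts t2 s2.
left; have [B [BA dB]] : exists B, (ctsub A `&` @Omega X) B /\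
    forall s, Sf s -> ~ s `<=` B.
  apply: contrapT => nB; apply: nSdense; split=> // B BA.
  apply: contrapT => SB; apply: nB; exists B; split=> // s Ss sB.
  by apply: SB; exists s; split=> //; split=> //; case: (SfA s Ss).
have [[BsubA _] BO] := BA.
have BU : B `<=` U by exact: subset_trans AU.
exists B; split=> //; split=> // s [sB s2].
case: (f12 s) => //; first by split=> //; exact: subset_trans BU.
by move=> fs; case: (dB s) => //; split=> //; split=> //; exact: subset_trans BsubA.
Qed.

Lemma NW_arrow : NW_OO X -> forall n k : nat, (0 < n)%N -> (0 < k)%N ->
  arrow (@Omega X) (@Omega X) n k.
Proof.
move=> NWX n k n0 k0 U UO f fk; have [A [AU [cA AO]]] := omega_lindelof UO.
have [e eA] := omega_enum cA AO.
have Act : @ctOmega X A by split=> //; split=> //; exact: omega_cover_infinite.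
have thin : thin_fam e A (msub A n).
  split=> [s [sA sn]|s t [_ sn] [_ tn] st [_ [sub _]]].
    by split=> //; apply/finite_setP; exists n.
  by apply: st; exact: card_eq_sub sub sn tn.
have [] := NWX A e Act eA _ thin k (fun i => [set s | msub A n s /\ f s = i]) k0.
- apply/seteqP; split=> [s sn|s [i _ []//]].
  exists (f s) => //; apply: fk; case: sn => sA sn; split=> //.
  exact: subset_trans AU.
- by move=> i j _ _ ij; rewrite -subset0 => s [[_ si] [_ sj]]; apply: ij; rewrite -si.
move=> B [i [[[BA Bct] BO] [ik dB]]].
exists i; split=> //; exists B; split; first exact: subset_trans AU.
split=> // s [sB sn].
suff : (finsub B `&` msub A n) s by move=> /dB[].
split; first by split=> //; apply/finite_setP; exists n.
by split=> //; exact: subset_trans BA.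
Qed.

Lemma arrow_arrow_sq n k l : (0 < l)%N -> arrow (@Omega X) (@Omega X) n k ->
  arrow_sq (@Omega X) (@Omega X) n k l.
Proof.
move=> l0 arr U UO f /(arr U UO f)[i [_ [V [VU [VO Vi]]]]].
exists V; split=> //; split=> //.
apply: (@card_le_trans _ _ _ [set i]).
  by apply: subset_card_le => _ [s sV <-]; rewrite (Vi s sV).
apply: (@card_le_trans _ _ _ `I_1); last by rewrite card_le_II.
by have := @card_set1 _ i; rewrite card_eq_le => /andP[].
Qed.

Lemma arrow_arrow2_four : arrow (@Omega X) (@Omega X) 3 2 ->
  arrow2 (@Omega X) (@Omega X) four_sets 3.
Proof.
move=> arr U UO f f12.
have [|i [ik [V [VU [VO Vi]]]]] := arr U UO f.
  by move=> s /f12[->|->].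
have [i1|i2] : i = 1%N \/ i = 2%N by lia.
  by left; exists V; split=> //; split=> // s /Vi->.
right; have [A [AV [cA AO]]] := omega_lindelof VO.
have [e eA] := omega_enum cA AO.
have IA : e @` `I_4 `<=` A by exact: (@image_enum_sub _ _ _ eA).
exists (e @` `I_4); split; first by move=> a /IA/AV/VU.
split; first by apply: inj_card_eq => a b _ _; case: eA => einj _ /einj.
by move=> s [sI s3]; rewrite Vi //; split=> // a /sI/IA/AV.
Qed.

Lemma arrow_arrow2 : arrow (@Omega X) (@Omega X) 2 2 ->
  arrow2 (@Omega X) (@Omega X) (@Ocov X) 2.
Proof.
move=> arr U UO f f12.
have [|i [ik [V [VU [VO Vi]]]]] := arr U UO f.
  by move=> s /f12[->|->].
have [i1|i2] : i = 1%N \/ i = 2%N by lia.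
  by left; exists V; split=> //; split=> // s /Vi->.
by right; exists V; split=> //; split=> [|s /Vi->//]; case: VO.
Qed.

(** * Recovering S1 from the partition relations *)

Section Selection.
Variable O : nat -> set (set X).
Hypothesis OO : forall n, omega_cover (O n).

(** At a level [i] attained by [k] the common value of [g] is selected, so each [w] in [V] lies
    inside the set selected at level [k w]. *)
Lemma select_from V (k : set X -> nat) (g : set X -> set X) : omega_cover V ->
  (forall w, V w -> O (k w) (g w) /\ w `<=` g w) ->
  (forall w w', V w -> V w' -> k w = k w' -> g w = g w') ->
  exists T : nat -> set X, (forall n, O n (T n)) /\ @Omega X (range T).
Proof.
move=> /omega_coverP[_ _ VF] gP kg.
have /choice[T TP] : forall i, exists t, O i t /\ forall w, V w -> k w = i -> t = g w.
  move=> i; have [[w [Vw kw]]|nw] := pselect (exists w, V w /\ k w = i).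
    exists (g w); split; first by have [] := gP w Vw; rewrite kw.
    by move=> w' Vw' kw'; apply: kg => //; rewrite kw'.
  (* At a level that [k] does not attain, any member of [O i] serves. *)
  have /omega_coverP[_ _ /(_ set0 (finite_set0 _))[t Ot _]] := OO i.
  by exists t; split=> // w Vw kw; case: nw; exists w.
exists T; split; first by move=> n; case: (TP n).
apply/omega_coverP; split.
- by move=> _ [n _ <-]; apply: omega_cover_open (OO n) _; case: (TP n).
- move=> [n _ Tn]; have [x] := omega_cover_neqT (OO n) (TP n).1; apply.
  by rewrite Tn.
- move=> F /VF[w Vw Fw]; exists (T (k w)); first by exists (k w).
  have [_ /(_ w Vw erefl)->] := TP (k w).
  by move=> x /Fw; case: (gP w Vw) => _; apply.
Qed.

Lemma tree_cover : exists W (n m : set X -> nat) (z : set X -> set X)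
    (v : nat -> nat -> set X),
  [/\ omega_cover W, forall i j, O i (v i j) &
   forall w, W w -> [/\ w `<=` v 0%N (n w), w `<=` v (n w) (m w),
     O (choice.pickle (n w, m w)) (z w) & w `<=` z w]].
Proof.
have /choice[v vP] : forall i, exists v : nat -> set X,
    (forall j, O i (v j)) /\ omega_cover (range v).
  move=> i; have [V [VO [cV VOm]]] := omega_lindelof (OO i).
  have [e eV] := omega_enum cV VOm; exists e; split.
    by move=> j; apply: VO; exact: (enum_of_mem eV j).
  by case: eV => _ ->.
pose rep w (t : nat * nat * set X) := O (choice.pickle t.1) t.2 /\
  w = v 0%N t.1.1 `&` v t.1.1 t.1.2 `&` t.2.
pose W := [set w | exists t, rep w t].
(* One set may have several decompositions; [r] fixes one, from which [n], [m] and [z] are read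
   off. *)
have /choice[r rP] : forall w, exists t, W w -> rep w t.
  move=> w; have [[t wt]|nW] := pselect (W w); first by exists t.
  by exists (0%N, 0%N, set0).
exists W, (fun w => (r w).1.1), (fun w => (r w).1.2), (fun w => (r w).2), v; split.
- have vO i j : O i (v i j) by case: (vP i).
  apply/omega_coverP; split.
  + move=> w [[[i j] z] [/= Oz ->]].
    apply: openI; first by apply: openI; apply: omega_cover_open (OO _) (vO _ _).
    exact: omega_cover_open (OO _) Oz.
  + move=> [[[i j] z] [/= _ TE]].
    have [x] := omega_cover_neqT (OO 0%N) (vO 0%N i); apply.
    by have : [set: X] x by []; rewrite TE => -[[]].
  + move=> F finF.
    have /omega_coverP[_ _ /(_ F finF)[_ [i _ <-] Fi]] := (vP 0%N).2.
    have /omega_coverP[_ _ /(_ F finF)[_ [j _ <-] Fj]] := (vP i).2.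
    have /omega_coverP[_ _ /(_ F finF)[z Oz Fz]] := OO (choice.pickle (i, j)).
    exists (v 0%N i `&` v i j `&` z); first by exists (i, j, z).
    by move=> x Fx; split; [split; [exact: Fi|exact: Fj]|exact: Fz].
- by move=> i j; case: (vP i).
- move=> w /rP[Oz wE]; rewrite -surjective_pairing; split=> //.
  + by rewrite {1}wE => x [[]].
  + by rewrite {1}wE => x [[]].
  + by rewrite {1}wE => x [].
Qed.

Variables (W : set (set X)) (n m : set X -> nat) (z : set X -> set X).
Variable v : nat -> nat -> set X.
Hypothesis WO : omega_cover W.
Hypothesis vO : forall i j, O i (v i j).
Hypothesis wP : forall w, W w -> [/\ w `<=` v 0%N (n w), w `<=` v (n w) (m w),
     O (choice.pickle (n w, m w)) (z w) & w `<=` z w].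

(** If [n] were bounded on [V], finitely many proper sets [v 0 i] would absorb all members of
    [V]. *)
Lemma tree_unbounded V : V `<=` W -> omega_cover V ->
  forall N, exists2 w, V w & (N <= n w)%N.
Proof.
move=> VW VO N; apply: contrapT => nV.
apply: (@omega_cover_not_bounded _ V N (v 0%N)) => //.
  by move=> i _; apply: omega_cover_neqT (OO 0%N) (vO _ _).
move=> w Vw; exists (n w); last by case: (wP (VW w Vw)).
by rewrite ltnNge; apply/negP => Nw; apply: nV; exists w.
Qed.

Lemma tree_select_fst V : V `<=` W -> omega_cover V ->
  (forall w w', V w -> V w' -> n w = n w' -> m w = m w') ->
  exists T : nat -> set X, (forall n, O n (T n)) /\ @Omega X (range T).
Proof.
move=> VW VO nm; apply: (@select_from V n (fun w => v (n w) (m w))) => //.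
  by move=> w /VW/wP[].
by move=> w w' Vw Vw' nw; rewrite (nm w w') // nw.
Qed.

Lemma tree_select_snd V : V `<=` W -> omega_cover V ->
  (forall w w', V w -> V w' -> n w = n w' -> m w = m w' -> w = w') ->
  exists T : nat -> set X, (forall n, O n (T n)) /\ @Omega X (range T).
Proof.
move=> VW VO nm; apply: (@select_from V (fun w => choice.pickle (n w, m w)) z) => //.
  by move=> w /VW/wP[].
move=> w w' Vw Vw' /(pcan_inj (@choice.pickleK _))[nw mw].
by rewrite (nm w w').
Qed.

(** Pairs with equal [n] get colour 2. On a set of colour 1, [n] is injective and so determines [m].
    On a set of colour 2, [n] is constant and all members lie in one proper set [v 0 n], so they do
    not cover. *)
Lemma tree_arrow2_select : arrow2 (@Omega X) (@Omega X) (@Ocov X) 2 ->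
  exists T : nat -> set X, (forall n, O n (T n)) /\ @Omega X (range T).
Proof.
move=> arr.
pose same s := exists w w', [/\ s w, s w', w <> w' & n w = n w'].
have [|[V [VW [VO V1]]]|[V [VW [VO V2]]]] :=
    arr W WO (fun s => if pselect (same s) then 2%N else 1%N).
- by move=> s _ /=; case: pselect => ?; [right|left].
- apply: (tree_select_fst VW VO) => w w' Vw Vw' nw.
  have [->//|ww'] := pselect (w = w').
  have := V1 _ (msub_set2 Vw Vw' ww'); case: pselect => // -[].
  by exists w, w'; split=> //; [left|right].
- exfalso; have sameV w w' : V w -> V w' -> n w = n w'.
    move=> Vw Vw'; have [->//|ww'] := pselect (w = w').
    have := V2 _ (msub_set2 Vw Vw' ww'); case: pselect => // sm _; case: sm => a [b []].
    by move=> [->|->] [->|->].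
  (* A point of the space is needed to see that [V] is nonempty. *)
  have [x0 _] := omega_cover_neqT (OO 0%N) (vO 0%N 0%N).
  have [_ Vcov] := VO.
  have [w0 Vw0 _] : (\bigcup_(u in V) u) x0 by rewrite Vcov.
  have [x] := omega_cover_neqT (OO 0%N) (vO 0%N (n w0)); apply.
  have [w Vw wx] : (\bigcup_(u in V) u) x by rewrite Vcov.
  by rewrite (sameV w0 w) //; have [+ _ _ _] := wP (VW w Vw); apply.
Qed.

(** The colours record whether [n] differs, only [m] differs, or both agree. Colour 1 occurs because
    [n] is unbounded; if colour 2 is missing, [n] determines [m], and if colour 3 is missing, [n]
    and [m] determine the set. *)
Lemma tree_arrow_sq_select : arrow_sq (@Omega X) (@Omega X) 2 3 2 ->
  exists T : nat -> set X, (forall n, O n (T n)) /\ @Omega X (range T).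
Proof.
move=> arr.
pose split1 s := exists w w', [/\ s w, s w' & n w <> n w'].
pose split2 s := exists w w', [/\ s w, s w' & m w <> m w'].
pose f s := if pselect (split1 s) then 1%N else if pselect (split2 s) then 2%N else 3%N.
have [|V [VW [VO Vf]]] := arr W WO f.
  by move=> s _; rewrite /f; case: pselect => //= ?; case: pselect.
have f1 w w' : n w <> n w' -> f [set w; w'] = 1%N.
  by move=> nw; rewrite /f; case: pselect => // -[]; exists w, w'; split=> //; [left|right].
have nsplit1 w w' : n w = n w' -> ~ split1 [set w; w'].
  by move=> nw [a [b []]] [->|->] [->|->]; apply.
have nsplit2 w w' : m w = m w' -> ~ split2 [set w; w'].
  by move=> mw [a [b []]] [->|->] [->|->]; apply.
have f2 w w' : n w = n w' -> m w <> m w' -> f [set w; w'] = 2%N.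
  move=> /nsplit1 nw mw; rewrite /f; case: pselect => //= ?.
  by case: pselect => // -[]; exists w, w'; split=> //; [left|right].
have f3 w w' : n w = n w' -> m w = m w' -> f [set w; w'] = 3%N.
  by move=> /nsplit1 nw /nsplit2 mw; rewrite /f; case: pselect => //= ?; case: pselect.
have [w1|nw1] := pselect (exists w w', [/\ V w, V w' & n w <> n w']); last first.
  have [w Vw _] := tree_unbounded VW VO 0%N.
  have [w' Vw' nww'] := tree_unbounded VW VO (n w).+1.
  by exfalso; apply: nw1; exists w, w'; split=> //; lia.
have [w2|nw2] := pselect (exists w w', [/\ V w, V w', n w = n w' & m w <> m w']); last first.
  apply: (tree_select_fst VW VO) => w w' Vw Vw' nw; apply: contrapT => mw.
  by apply: nw2; exists w, w'.
have [w3|nw3] := pselect (exists w w', [/\ V w, V w', w <> w', n w = n w' & m w = m w']); last first.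
  apply: (tree_select_snd VW VO) => w w' Vw Vw' nw mw; apply: contrapT => ww'.
  by apply: nw3; exists w, w'.
(* All of the colours 1, 2, 3, the successors of the elements of [I_3], would be attained. *)
exfalso; suff : `I_3 #<= `I_2 by rewrite card_le_II.
apply: card_le_trans Vf; apply: (@card_le_trans _ _ _ (succn @` `I_3)).
  have : succn @` `I_3 #= `I_3 by apply: inj_card_eq => a b _ _ [].
  by rewrite card_eq_le => /andP[].
apply: subset_card_le => _ [i i3 <-].
case: i i3 => [|[|[|//]]] _.
- have [w [w' [Vw Vw' nw]]] := w1; exists [set w; w']; last exact: f1.
  by apply: msub_set2 => // ww'; apply: nw; rewrite ww'.
- have [w [w' [Vw Vw' nw mw]]] := w2; exists [set w; w']; last exact: f2.
  by apply: msub_set2 => // ww'; apply: mw; rewrite ww'.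
- have [w [w' [Vw Vw' ww' nw mw]]] := w3; exists [set w; w']; last exact: f3.
  exact: msub_set2.
Qed.

(** Colour 2 marks the triples in which two members share a value of [n] and the third has a larger
    one. On an omega-cover of colour 1, no two members share a value, since unboundedness would
    supply the third. Four points of colour 2 admit neither a constant triple nor three distinct
    values, so they split two and two; the pair with the larger value and a third point then
    contradict the inequality. *)
Lemma tree_arrow2_four_select : arrow2 (@Omega X) (@Omega X) four_sets 3 ->
  exists T : nat -> set X, (forall n, O n (T n)) /\ @Omega X (range T).
Proof.
move=> arr.
(* The inequality rules out four points whose n-values are x, x, y, y. *)
pose bad s := exists a b c, [/\ s a, s b, s c, a <> b & n a = n b /\ (n a < n c)%N].
have [|[V [VW [VO V1]]]|[V [VW [V4 V2]]]] :=
    arr W WO (fun s => if pselect (bad s) then 2%N else 1%N).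
- by move=> s _ /=; case: pselect => ?; [right|left].
- apply: (tree_select_fst VW VO) => a b Va Vb nab.
  have [->//|ab] := pselect (a = b).
  have [c Vc nac] := tree_unbounded VW VO (n a).+1.
  have ac : a <> c by move=> ac; rewrite ac in nac; lia.
  have bc : b <> c by move=> bc; rewrite nab bc in nac; lia.
  have := V1 _ (msub_set3 Va Vb Vc ab ac bc); case: pselect => // -[].
  by exists a, b, c; split=> //; [left; left|left; right|right].
- exfalso; move: V4 => /eq_cardSP[a Va] /eq_cardSP[b [Vb ba]] /eq_cardSP[c [[Vc ca] cb]].
  move=> /eq_cardSP[d [[[Vd da] db] dc] _].
  have triple x y t : V x -> V y -> V t -> x <> y -> x <> t -> y <> t ->
      (n x = n y /\ n x < n t)%N \/ (n x = n t /\ n x < n y)%N \/ (n y = n t /\ n y < n x)%N.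
    move=> Vx Vy Vt xy xt yt.
    have := V2 _ (msub_set3 Vx Vy Vt xy xt yt); case: pselect => // sm _; case: sm => p [q [r []]].
    by move=> [[->|->]|->] [[->|->]|->] [[->|->]|->] pq [npq nqr]; (lia || congruence).
  have t1 := triple a b c Va Vb Vc (nesym ba) (nesym ca) (nesym cb).
  have t2 := triple a b d Va Vb Vd (nesym ba) (nesym da) (nesym db).
  have t3 := triple a c d Va Vc Vd (nesym ca) (nesym da) (nesym dc).
  have t4 := triple b c d Vb Vc Vd (nesym cb) (nesym db) (nesym dc).
  lia.
Qed.
End Selection.
End Implications.

(** * Closing the circle of implications *)

Theorem theorem7p2 (X : topologicalType) :
  hausdorff_space X ->
  (forall U : set (set X), omega_cover U ->
     exists V, V `<=` U /\ countable V /\ omega_cover V) ->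
  let P1 := S1 (@Omega X) (@Omega X) in
  (P1 <-> E_OO X) /\
  (P1 <-> GP_OO X) /\
  (P1 <-> FG_OO X) /\
  (P1 <-> NW_OO X) /\
  (P1 <-> (forall n k : nat, (0 < n)%N -> (0 < k)%N ->
             arrow (@Omega X) (@Omega X) n k)) /\
  (P1 <-> (forall n k : nat, (0 < n)%N -> (0 < k)%N ->
             arrow_sq (@Omega X) (@Omega X) n k 2)) /\
  (P1 <-> arrow_sq (@Omega X) (@Omega X) 2 3 2) /\
  (P1 <-> arrow2 (@Omega X) (@Omega X) four_sets 3) /\
  (P1 <-> arrow (@Omega X) (@Omega X) 2 2) /\
  (P1 <-> arrow2 (@Omega X) (@Omega X) (@Ocov X) 2).
Proof.
move=> _ lindelof P1.
have i12 : P1 -> E_OO X := @S1_E X.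
have i23 : E_OO X -> GP_OO X := @E_GP X.
have i34 : GP_OO X -> FG_OO X := @GP_FG X.
have i35 : GP_OO X -> NW_OO X := @GP_NW X.
have i4b := FG_arrow2 lindelof.
have i56 := NW_arrow lindelof.
have iab := @arrow_arrow2 X.
have ib1 : arrow2 (@Omega X) (@Omega X) (@Ocov X) 2 -> P1.
  move=> arr O OO; have [W [n [m [z [v [WO vO wP]]]]]] := tree_cover lindelof OO.
  exact: (tree_arrow2_select OO WO vO wP arr).
have i81 : arrow_sq (@Omega X) (@Omega X) 2 3 2 -> P1.
  move=> arr O OO; have [W [n [m [z [v [WO vO wP]]]]]] := tree_cover lindelof OO.
  exact: (tree_arrow_sq_select OO WO vO wP arr).
have i91 : arrow2 (@Omega X) (@Omega X) four_sets 3 -> P1.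
  move=> arr O OO; have [W [n [m [z [v [WO vO wP]]]]]] := tree_cover lindelof OO.
  exact: (tree_arrow2_four_select OO WO vO wP arr).
have i16 : P1 -> forall n k : nat, (0 < n)%N -> (0 < k)%N ->
    arrow (@Omega X) (@Omega X) n k by move=> /i12/i23/i35/i56.
have i61 : (forall n k : nat, (0 < n)%N -> (0 < k)%N ->
    arrow (@Omega X) (@Omega X) n k) -> P1 by move=> arr; apply/ib1/iab/arr.
(* Chaining the implications leaves those from [P1] to the two square-bracket relations and to the
   one with four-element sets. *)
do !split; auto.
- by move=> p n k n0 k0; apply: arrow_arrow_sq => //; exact: i16.
- by move=> p; apply: arrow_arrow_sq => //; exact: i16.
- by move=> p; apply: arrow_arrow2_four => //; exact: i16.
Qed.
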